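(* Let $F$ be a field and let $L$ be a cyclic Leibniz algebra of type (II) over $F$, with basis $a_1,\ldots,a_n$ and $[a_1,a_n]=\alpha_2a_2+\ldots+\alpha_na_n$, $\alpha_2\neq 0$, as described in the context. Then $G=\mathbf{Aut}_{[,]}(L)$ includes a normal subgroup $C$ which is isomorphic to $$\mathbf{U}(F[X]/\mathbf{a}(X)F[X]),$$ where $\mathbf{a}(X)=\alpha_2+\alpha_3X+\ldots+\alpha_nX^{n-2}-X^{n-1}$, such that $G/C$ is isomorphic to a subgroup of the multiplicative group of the field $F$.
   Context: A (left) Leibniz algebra over a field $F$ is an $F$-vector space $L$ with a bilinear operation $[,]$ satisfying $[[a,b],c]=[a,[b,c]]-[b,[a,c]]$ for all $a,b,c\in L$. An endomorphism of $L$ is a linear transformation $f$ of $L$ with $f([a,b])=[f(a),f(b)]$ for all $a,b$; an automorphism is a bijective endomorphism; $\mathbf{Aut}_{[,]}(L)$ is the group of all automorphisms of $L$ under composition. A Leibniz algebra is cyclic if it is generated by one element $a$. A finite-dimensional cyclic Leibniz algebra $L=\langle a\rangle$ has a basis $a_1,\ldots,a_n$ with $a_1=a$, $a_2=[a_1,a_1]$, $\ldots$, $a_n=[a_1,a_{n-1}]$ and $[a_1,a_n]=\alpha_2a_2+\ldots+\alpha_na_n$ for some $\alpha_i\in F$; moreover $[L,L]=Fa_2+\ldots+Fa_n$, and $[a_j,y]=0$ for all $j\geqslant 2$ and $y\in L$. $L$ is of type (II) if $\alpha_2\neq0$ (so $n\geqslant 2$). $\mathbf{U}(R)$ denotes the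 group of units of a ring $R$. *)

(* Defs.v *)
From HB Require Import structures.
From mathcomp Require Import all_boot all_order all_algebra.
From mathcomp Require Import generic_quotient ring_quotient sesquilinear.
From mathcomp Require Import boolp.

Set Implicit Arguments.
Unset Strict Implicit.
Unset Printing Implicit Defensive.

Import GRing.Theory.

Local Open Scope ring_scope.
Local Open Scope quotient_scope.

Definition isog (G H : groupType) : Prop :=
  exists f : {multiplicative G -> H}, bijective f.

(* A subgroup, given as a predicate closed under the group operations, seen   *)
(* as a group in its own right.                                               *)
Definition subgroup_of (G : groupType) (S : groupClosed G) :=
  {x : G | x \in (S : {pred G})}.

Section SubgroupOf.
Variables (G : groupType) (S : groupClosed G).

Fact subgroup_of_closed : group_closed (S : {pred G}).
Proof.
by split=> [|x y xS yS]; [exact: gpred1 | apply/gpredM => //; exact: gpredVr].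
Qed.

HB.instance Definition _ := [isSub of subgroup_of S for @sval _ _].
HB.instance Definition _ := [Choice of subgroup_of S by <:].
HB.instance Definition _ :=
  SubChoice_isSubGroup.Build G _ (subgroup_of S) subgroup_of_closed.

End SubgroupOf.

HB.mixin Record isConjClosed (G : groupType) (S : {pred G}) := {
  gpredJr : forall x y : G, x \in S -> (x ^ y)%g \in S
}.

#[short(type="normalClosed")]
HB.structure Definition NormalClosed (G : groupType) :=
  {S of GroupClosed G S & isConjClosed G S}.

(* The quotient group G / C: classes for x ~ y :<-> x^-1 * y \in C, that is,  *)
(* cosets of C, with the multiplication induced by that of G.                 *)
Section QuotientGroup.
Variables (G : groupType) (C : normalClosed G).
Local Open Scope group_scope.

Definition coset_equiv (x y : G) : bool := (x^-1 * y) \in (C : {pred G}).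

Fact coset_equiv_is_equiv : equiv_class_of coset_equiv.
Proof.
split=> [x|x y|y x z]; rewrite /coset_equiv.
- by rewrite mulVg gpred1.
- by apply/idP/idP=> /gpredVr; rewrite invgM invgK.
- by move=> xy yz; rewrite -[x^-1](mulgK y) -mulgA gpredM.
Qed.

Canonical coset_equiv_equiv := EquivRelPack coset_equiv_is_equiv.
Canonical coset_equiv_encModRel := defaultEncModRel coset_equiv.

Definition quotient_group := {eq_quot coset_equiv}.

HB.instance Definition _ : EqQuotient G coset_equiv quotient_group :=
  EqQuotient.on quotient_group.
HB.instance Definition _ := Choice.on quotient_group.

Local Notation Q := quotient_group.

Definition qone : Q := \pi_Q 1.
Definition qinv (u : Q) : Q := \pi_Q (repr u)^-1.
Definition qmul (u v : Q) : Q := \pi_Q (repr u * repr v).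

Fact pi_coset (x y : G) :
  (\pi_Q x = \pi_Q y) <-> (x^-1 * y) \in (C : {pred G}).
Proof.
split=> [/eqmodP//|xy]; exact/eqmodP.
Qed.

Fact repr_coset (x : G) : (x^-1 * repr (\pi_Q x)) \in (C : {pred G}).
Proof. by apply/pi_coset; rewrite reprK. Qed.

Fact pi_qmul (x y : G) : \pi_Q (x * y) = qmul (\pi_Q x) (\pi_Q y).
Proof.
apply/pi_coset; set x' := repr _; set y' := repr _.
have -> : (x * y)^-1 * (x' * y') = ((x^-1 * x') ^ y) * (y^-1 * y').
  by rewrite conjgE invgM !mulgA mulgK.
by rewrite gpredM ?gpredJr// repr_coset.
Qed.

Fact pi_qinv (x : G) : \pi_Q x^-1 = qinv (\pi_Q x).
Proof.
apply/pi_coset; set x' := repr _.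
have -> : x^-1^-1 * x'^-1 = ((x^-1 * x')^-1) ^ x^-1.
  by rewrite conjgE !invgM !invgK !mulgA mulgK.
by rewrite gpredJr// gpredVr// repr_coset.
Qed.

Fact qmulA : associative qmul.
Proof.
elim/quotW=> x; elim/quotW=> y; elim/quotW=> z.
by rewrite -(pi_qmul y z) -(pi_qmul x y) -(pi_qmul x) -pi_qmul mulgA.
Qed.

Fact qmul1 : left_id qone qmul.
Proof. by elim/quotW=> x; rewrite -pi_qmul mul1g. Qed.

Fact qmulr1 : right_id qone qmul.
Proof. by elim/quotW=> x; rewrite -pi_qmul mulg1. Qed.

Fact qmulV : left_inverse qone qinv qmul.
Proof. by elim/quotW=> x; rewrite -pi_qinv -pi_qmul mulVg. Qed.

Fact qmulrV : right_inverse qone qinv qmul.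
Proof. by elim/quotW=> x; rewrite -pi_qinv -pi_qmul mulgV. Qed.

HB.instance Definition _ :=
  isGroup.Build quotient_group qmulA qmul1 qmulr1 qmulV qmulrV.

End QuotientGroup.

(* The group U(R) of units of a ring R. A unit is represented by the pair of  *)
(* a ring element and its (unique) two-sided inverse: unlike GRing.unit, this *)
(* does not require R to come with a computable inverse.                      *)
Definition unit_pair (R : nzRingType) : pred (R * R) :=
  fun u => (u.1 * u.2 == 1) && (u.2 * u.1 == 1).

Definition unit_group (R : nzRingType) := {u : R * R | unit_pair u}.

Section UnitGroup.
Variable R : nzRingType.
Local Notation U := (unit_group R).

HB.instance Definition _ := Choice.on U.

Fact unit_one_subproof : unit_pair ((1, 1) : R * R).
Proof. by rewrite /unit_pair mulr1 eqxx. Qed.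

Fact unit_inv_subproof (u : U) : unit_pair ((val u).2, (val u).1).
Proof. by rewrite /unit_pair andbC; exact: (valP u). Qed.

Fact unit_mul_subproof (u v : U) :
  unit_pair ((val u).1 * (val v).1, (val v).2 * (val u).2).
Proof.
case: u v => [[x x'] /andP[/= /eqP xx' /eqP x'x]].
case=> [[y y'] /andP[/= /eqP yy' /eqP y'y]].
apply/andP; split=> /=; apply/eqP.
- by rewrite mulrA -(mulrA x) yy' mulr1.
- by rewrite mulrA -(mulrA y') x'x mulr1.
Qed.

Definition unit_one : U := Sub (1, 1) unit_one_subproof.
Definition unit_inv (u : U) : U := Sub _ (unit_inv_subproof u).
Definition unit_mul (u v : U) : U := Sub _ (unit_mul_subproof u v).

Fact unit_mulA : associative unit_mul.
Proof. by move=> u v w; apply/val_inj; rewrite /= !mulrA. Qed.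

Fact unit_mul1 : left_id unit_one unit_mul.
Proof.
by move=> u; apply/val_inj; rewrite /= mul1r mulr1 -surjective_pairing.
Qed.

Fact unit_mulr1 : right_id unit_one unit_mul.
Proof.
by move=> u; apply/val_inj; rewrite /= mul1r mulr1 -surjective_pairing.
Qed.

Fact unit_mulV : left_inverse unit_one unit_inv unit_mul.
Proof. by move=> u; apply/val_inj => /=; case/andP: (valP u) => _ /eqP->. Qed.

Fact unit_mulrV : right_inverse unit_one unit_inv unit_mul.
Proof. by move=> u; apply/val_inj => /=; case/andP: (valP u) => /eqP-> _. Qed.

HB.instance Definition _ :=
  isGroup.Build (unit_group R)
    unit_mulA unit_mul1 unit_mulr1 unit_mulV unit_mulrV.

End UnitGroup.

(* The ideal p F[X]; it has to be proper for {ideal_quot _} to be a ring,     *)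
(* hence the proof argument.                                                  *)
Definition principal_ideal (F : fieldType) (p : {poly F})
  (p_gt1 : (1 < size p)%N) : {pred {poly F}} := fun q => p %| q.

Section PrincipalIdeal.
Variables (F : fieldType) (p : {poly F}) (p_gt1 : (1 < size p)%N).

Fact principal_ideal_closed : idealr_closed (principal_ideal p_gt1).
Proof.
split; rewrite ?unfold_in /principal_ideal ?dvdp0//.
  by rewrite dvdp1 neq_ltn p_gt1 orbT.
by move=> a u v pu pv; rewrite /in_mem /= dvdp_add ?dvdp_mull.
Qed.

HB.instance Definition _ :=
  isIdealr.Build {poly F} (principal_ideal p_gt1) principal_ideal_closed.

End PrincipalIdeal.

HB.mixin Record Lmodule_isLeibniz (F : fieldType) L of GRing.Lmodule F L := {
  bracket : L -> L -> L;
  bracket_bilinear : bilinear_for *:%R *:%R bracket;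
  bracket_leibniz : forall a b c : L,
    bracket (bracket a b) c = bracket a (bracket b c) - bracket b (bracket a c)
}.

#[short(type="leibnizVectType")]
HB.structure Definition LeibnizVector (F : fieldType) :=
  {L of Vector F L & Lmodule_isLeibniz F L}.

Notation "\[ a , b ]" := (bracket a b)
  (at level 0, a, b at level 99, format "\[ a ,  b ]") : ring_scope.

Section Leibniz.
Variables (F : fieldType) (L : leibnizVectType F).

Definition is_leibniz_aut (f : 'End(L)) : bool :=
  `[< bijective f /\ forall a b : L, f \[a, b] = \[f a, f b] >].

Definition leibniz_aut := {f : 'End(L) | is_leibniz_aut f}.

HB.instance Definition _ := Choice.on leibniz_aut.

Fact leibniz_aut1_subproof : is_leibniz_aut \1%VF.
Proof.
apply/asboolP; split; last by move=> a b; rewrite !id_lfunE.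
by exists id => a; rewrite id_lfunE.
Qed.

Fact leibniz_autM_subproof (f g : leibniz_aut) :
  is_leibniz_aut (val f \o val g)%VF.
Proof.
have /asboolP[fb fM] := valP f; have /asboolP[gb gM] := valP g.
apply/asboolP; split; last by move=> a b; rewrite !comp_lfunE gM fM.
by apply: (eq_bij (bij_comp fb gb)) => a; rewrite comp_lfunE.
Qed.

Fact leibniz_aut_lker0 (f : leibniz_aut) : lker (val f) == 0%VS.
Proof.
by have /asboolP[fb _] := valP f; apply/lker0P; exact: bij_inj.
Qed.

Fact leibniz_autV_subproof (f : leibniz_aut) : is_leibniz_aut (val f)^-1%VF.
Proof.
have f0 := leibniz_aut_lker0 f; have /asboolP[fb fM] := valP f.
have fK := lker0_lfunK f0; have fVK : cancel (val f)^-1%VF (val f).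
  by case: fb => g gK Kg a; rewrite -[a]Kg fK.
apply/asboolP; split; first by exists (val f).
by move=> a b; apply: (bij_inj fb); rewrite fM !fVK.
Qed.

Definition leibniz_aut1 : leibniz_aut := Sub _ leibniz_aut1_subproof.
Definition leibniz_autM (f g : leibniz_aut) : leibniz_aut :=
  Sub _ (leibniz_autM_subproof f g).
Definition leibniz_autV (f : leibniz_aut) : leibniz_aut :=
  Sub _ (leibniz_autV_subproof f).

Fact leibniz_autMA : associative leibniz_autM.
Proof. by move=> f g h; apply/val_inj; rewrite /= comp_lfunA. Qed.

Fact leibniz_autM1 : left_id leibniz_aut1 leibniz_autM.
Proof. by move=> f; apply/val_inj; rewrite /= comp_lfun1l. Qed.

Fact leibniz_autMr1 : right_id leibniz_aut1 leibniz_autM.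
Proof. by move=> f; apply/val_inj; rewrite /= comp_lfun1r. Qed.

Fact leibniz_autMV : left_inverse leibniz_aut1 leibniz_autV leibniz_autM.
Proof.
by move=> f; apply/val_inj; rewrite /= lker0_compVf // leibniz_aut_lker0.
Qed.

Fact leibniz_autMrV : right_inverse leibniz_aut1 leibniz_autV leibniz_autM.
Proof.
by move=> f; apply/val_inj; rewrite /= lker0_compfV // leibniz_aut_lker0.
Qed.

HB.instance Definition _ :=
  isGroup.Build leibniz_aut
    leibniz_autMA leibniz_autM1 leibniz_autMr1 leibniz_autMV leibniz_autMrV.

Definition leibniz_subalgebra (U : {vspace L}) : Prop :=
  {in U &, forall x y : L, \[x, y] \in U}.

Definition generated_by (a : L) : Prop :=
  forall U : {vspace L}, leibniz_subalgebra U -> a \in U -> U = fullv.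

(* Sequences are numbered from 1 (coefficients from 2): only a 1, ..., a n    *)
(* and alpha 2, ..., alpha n matter.                                          *)
Definition cyclic_basis (n : nat) (a : nat -> L) (alpha : nat -> F) : Prop :=
  [/\ basis_of fullv [seq a i | i <- iota 1 n],
      forall i : nat, (1 <= i < n)%N -> a i.+1 = \[a 1%N, a i]
    & \[a 1%N, a n] = \sum_(2 <= i < n.+1) alpha i *: a i].

End Leibniz.

Arguments leibniz_aut {F} L.

Definition cyclic_poly (F : fieldType) (n : nat) (alpha : nat -> F) : {poly F} :=
  \sum_(2 <= i < n.+1) alpha i *: 'X^(i - 2) - 'X^(n - 1).

Fact size_cyclic_poly_gt1 (F : fieldType) (n : nat) (alpha : nat -> F) :
  (1 < n)%N -> (1 < size (cyclic_poly n alpha))%N.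
Proof.
case: n => [|[|n]] // _; rewrite /cyclic_poly subn1 /= addrC.
rewrite size_polyDl size_polyN size_polyXn //.
apply: leq_ltn_trans (size_sum _ _ _) _; rewrite ltnS big_seq.
elim/big_ind: _ => // [x y xn yn|i]; first by rewrite geq_max xn.
rewrite mem_index_iota => /andP[i2 iN].
apply: leq_trans (size_scale_leq _ _) _; rewrite size_polyXn.
by rewrite -subSn // leq_subLR add2n.
Qed.

(* Main.v *)
Require Import Defs.
From HB Require Import structures.
From mathcomp Require Import all_boot all_order all_algebra.
From mathcomp Require Import generic_quotient ring_quotient sesquilinear.
From mathcomp Require Import boolp.

Set Implicit Arguments.
Unset Strict Implicit.
Unset Printing Implicit Defensive.

Import GRing.Theory.
Local Open Scope ring_scope.
Local Open Scope quotient_scope.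

(** Let D be the left multiplication by a_1, K = F a_2 + ... + F a_n, and let
lam be the coordinate along a_1. Since a_2, ..., a_n annihilate L from the
left, the whole bracket is encoded by D and lam: [x, y] = lam(x) D(y)
([cyclic_bracket]). The operator D maps L into K, and K is a cyclic
F[X]-module for the action of X by D: it is generated by a_2, and the
annihilator of a_2 is generated by the polynomial p of the statement, so that
K is isomorphic to F[X]/(p) ([act_eq0], [act_surj]).

The hypothesis that alpha_2 = p(0) is nonzero makes X invertible modulo p, so
that D is bijective on K. Hence a_1 can be corrected by an element of K to a
vector c with D(c) = 0 and lam(c) = 1, and L = F c + K is a decomposition into
D-stable subspaces ([cyclic_split]).

An automorphism f satisfies lam(f x) = g lam(x), f D = g D f and f(c) = g c,
where the scalar g = lam(f c), the weight of f, is invertible ([aut_lam],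
[aut_D], [aut_c]). The weight is a homomorphism from the automorphism group to
the multiplicative group of F; C is its kernel, and the first isomorphism
theorem ([first_isog]) embeds G/C into the multiplicative group of F.

The automorphisms of weight 1 are the linear bijections that fix c, stabilize
K and commute with D there. On the cyclic module K they are the
multiplications by the units of F[X]/(p), and conversely each such
multiplication, extended by the identity on F c, is an automorphism of weight
1 ([extend_ker_bij]). *)

(** * Groups *)

Lemma inj_surj_bij (T : choiceType) (U : eqType) (f : T -> U) :
  injective f -> (forall y, exists x, f x = y) -> bijective f.
Proof.
move=> f_inj f_surj.
have f_surjb y : exists x, f x == y by have [x <-] := f_surj y; exists x.
have fK y : f (xchoose (f_surjb y)) = y by exact/eqP/(xchooseP (f_surjb y)).
by exists (fun y => xchoose (f_surjb y)) => // x; apply: f_inj.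
Qed.

Lemma isog_sym (G H : groupType) : isog G H -> isog H G.
Proof.
case=> f [g fK gK].
have gM : {morph g : x y / (x * y)%g}.
  by move=> x y; apply: (can_inj fK); rewrite gmulfM !gK.
pose gmul := isMultiplicative.Build H G g gM.
by exists (HB.pack_for {multiplicative H -> G} g gmul); exists f.
Qed.

Section FirstIsomorphismTheorem.
Variables (G H : groupType) (f : UMagmaMorphism.type G H).
Local Open Scope group_scope.

Definition gker : {pred G} := fun x => f x == 1.
Definition gimage : {pred H} := fun y => `[< exists x, f x = y >].

Lemma gkerE x : (x \in gker) = (f x == 1). Proof. by []. Qed.

Lemma gimageP y : reflect (exists x, f x = y) (y \in gimage).
Proof. exact: asboolP. Qed.

Fact gkerM : mulg_closed gker.
Proof.
by move=> x y; rewrite !gkerE gmulfM => /eqP-> /eqP->; rewrite mulg1.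
Qed.

Fact gker1 : 1 \in gker. Proof. by rewrite gkerE gmulf1. Qed.

Fact gkerV : invg_closed gker.
Proof. by move=> x; rewrite !gkerE gmulfV => /eqP->; rewrite invg1. Qed.

Fact gkerJ x y : x \in gker -> x ^ y \in gker.
Proof. by rewrite !gkerE gmulfJ => /eqP->; rewrite conj1g. Qed.

HB.instance Definition _ := isMulClosed.Build G gker gkerM.
HB.instance Definition _ := isMul1Closed.Build G gker gker1.
HB.instance Definition _ := isInvClosed.Build G gker gkerV.
HB.instance Definition _ := isConjClosed.Build G gker gkerJ.

Fact gimageM : mulg_closed gimage.
Proof.
move=> _ _ /gimageP[x <-] /gimageP[y <-]; apply/gimageP.
by exists (x * y); rewrite gmulfM.
Qed.

Fact gimage1 : 1 \in gimage.
Proof. by apply/gimageP; exists 1; rewrite gmulf1. Qed.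

Fact gimageV : invg_closed gimage.
Proof.
by move=> _ /gimageP[x <-]; apply/gimageP; exists x^-1; rewrite gmulfV.
Qed.

HB.instance Definition _ := isMulClosed.Build H gimage gimageM.
HB.instance Definition _ := isMul1Closed.Build H gimage gimage1.
HB.instance Definition _ := isInvClosed.Build H gimage gimageV.

Lemma pi_gker x y :
  (\pi_(quotient_group gker) x = \pi_(quotient_group gker) y) <-> f x = f y.
Proof.
rewrite pi_coset gkerE gmulfM gmulfV.
by split=> [/eqP/mulg1_eq|->]; rewrite ?invgK ?mulVg.
Qed.

(** The choice of the coset representatives is immaterial because f is constant
on cosets. *)
Definition quotient_to_image (u : quotient_group gker) : subgroup_of gimage :=
  Sub (f (repr u)) (introT (gimageP _) (ex_intro _ (repr u) erefl)).

Lemma quotient_to_imageE x : val (quotient_to_image (\pi x)) = f x.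
Proof. by apply/pi_gker; rewrite reprK. Qed.

Fact quotient_to_imageM : {morph quotient_to_image : u v / u * v}.
Proof.
move=> u v; apply: val_inj; rewrite [RHS]gmulfM.
apply: etrans (quotient_to_imageE (repr u * repr v)) _; exact: gmulfM.
Qed.

HB.instance Definition _ :=
  isMultiplicative.Build _ _ quotient_to_image quotient_to_imageM.

Lemma first_isog : isog (quotient_group gker) (subgroup_of gimage).
Proof.
exists quotient_to_image; apply: inj_surj_bij.
  move=> u v /(congr1 val) fuv; rewrite -[u]reprK -[v]reprK.
  exact/pi_gker.
move=> y; have /gimageP[x fx] := valP y.
by exists (\pi x); apply: val_inj; rewrite -fx; apply: quotient_to_imageE.
Qed.

End FirstIsomorphismTheorem.

(** * Polynomials in an endomorphism *)

Section PolyAction.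
Variables (F : fieldType) (V : vectType F) (V_proper : (0 < dim V)%N).
Variable (D : 'End(V)).

(** Polynomials in D are evaluated in the endomorphism ring of V, which is a
nontrivial ring because V is nonzero. *)
Definition poly_act (q : {poly F}) : 'End(V) :=
  horner_alg (D : lfun_algType V_proper) q.

Lemma poly_act_is_linear : linear poly_act.
Proof.
move=> k q r; rewrite /poly_act -mul_polyC rmorphD rmorphM /= horner_algC.
by rewrite mulr_algl.
Qed.

HB.instance Definition _ := GRing.isLinear.Build F {poly F} 'End(V) _
  poly_act poly_act_is_linear.

Lemma poly_actM q r x : poly_act (q * r) x = poly_act q (poly_act r x).
Proof.
(* The product of [lfun_algType] is composition in the opposite order. *)
by rewrite mulrC /poly_act rmorphM [LHS]comp_lfunE.
Qed.

Lemma poly_act1 x : poly_act 1 x = x.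
Proof. by rewrite /poly_act rmorph1 [LHS]id_lfunE. Qed.

Lemma poly_actX x : poly_act 'X x = D x.
Proof. by rewrite /poly_act /= horner_algX. Qed.

Lemma poly_actMXaddC q k x :
  poly_act (q * 'X + k%:P) x = poly_act q (D x) + k *: x.
Proof.
rewrite linearD add_lfunE poly_actM poly_actX -[k%:P]alg_polyC linearZ /=.
by rewrite scale_lfunE poly_act1.
Qed.

Lemma poly_act_comm (f : 'End(V)) :
  (forall x, f (D x) = D (f x)) ->
  forall q x, f (poly_act q x) = poly_act q (f x).
Proof.
move=> fD; elim/poly_ind=> [|q k IHq] x.
  by rewrite linear0 !lfunE /= linear0.
by rewrite !poly_actMXaddC linearD linearZ /= IHq fD.
Qed.

Lemma poly_actC q r x : poly_act q (poly_act r x) = poly_act r (poly_act q x).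
Proof. by rewrite -!poly_actM mulrC. Qed.

Lemma poly_actD q x : poly_act q (D x) = D (poly_act q x).
Proof. by rewrite -!poly_actX poly_actC. Qed.

Lemma scalar_poly_act (lam : {scalar V}) :
  (forall x, lam (D x) = 0) -> forall q x, lam x = 0 -> lam (poly_act q x) = 0.
Proof.
move=> lamD; elim/poly_ind=> [|q k IHq] x x0.
  by rewrite linear0 lfunE linear0.
by rewrite poly_actMXaddC linearD linearZ /= IHq ?lamD// x0 mulr0 addr0.
Qed.

End PolyAction.

(** * Quotients of F[X] and their units *)

Section IdealQuotient.
Variables (F : fieldType) (p : {poly F}) (p_gt1 : (1 < size p)%N).
Local Notation Q := {ideal_quot principal_ideal p_gt1}.

Lemma pi_principal q r : (\pi_Q q = \pi_Q r) <-> p %| q - r.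
Proof.
have -> : (p %| q - r) = (q - r \in principal_ideal p_gt1) by [].
by rewrite Quotient.idealrBE; split=> [->|/eqP].
Qed.

Lemma repr_quotM (u v : Q) : p %| repr (u * v) - repr u * repr v.
Proof. by apply/pi_principal; rewrite reprK rmorphM /= !reprK. Qed.

Lemma repr_quot1 : p %| repr (1 : Q) - 1.
Proof. by apply/pi_principal; rewrite reprK rmorph1. Qed.

End IdealQuotient.

Fact unit_group_inj (R : comNzRingType) (u v : unit_group R) :
  (val u).1 = (val v).1 -> u = v.
Proof.
case: u v => [[x x'] xK] [[y y'] yK] /= xy; apply: val_inj; rewrite /= -xy.
have /andP[/eqP/= xx' _] := xK; have /andP[/eqP/= yy' _] := yK.
congr (_, _); rewrite -[LHS]mulr1 -yy' -xy mulrA (mulrC x') xx'.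
by rewrite mul1r.
Qed.

(** * Automorphisms of a split algebra *)

Section SplitCyclic.
Variables (F : fieldType) (L : leibnizVectType F) (L_proper : (0 < dim L)%N).
Variables (D : 'End(L)) (lam : {scalar L}) (c e : L) (p : {poly F}).
Local Notation act := (poly_act L_proper D).

(** L is the direct sum of the line F c, killed by D, and of K = ker lam, which
is isomorphic to F[X]/(p) as an F[X]-module with generator e; the bracket only
depends on lam and D. The original generator of L has disappeared: every
automorphism maps c to one of its multiples, which need not be so for a_1. *)
Record split_cyclic : Prop := SplitCyclic {
  split_bracket : forall x y : L, \[x, y] = lam x *: D y;
  split_lam_c : lam c = 1;
  split_D_c : D c = 0;
  split_lam_D : forall x, lam (D x) = 0;
  split_D_inj : forall x, lam x = 0 -> D x = 0 -> x = 0;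
  split_lam_e : lam e = 0;
  split_act0 : forall q, act q e = 0 <-> p %| q;
  split_actP : forall x, lam x = 0 -> exists q, x = act q e
}.

Hypothesis splitL : split_cyclic.
Hypothesis p_gt1 : (1 < size p)%N.
Local Notation Q := {ideal_quot principal_ideal p_gt1}.

Let bracketE := split_bracket splitL.
Let lam_c := split_lam_c splitL.
Let D_c := split_D_c splitL.
Let lam_D := split_lam_D splitL.
Let D_inj := split_D_inj splitL.
Let lam_e := split_lam_e splitL.
Let act0 := split_act0 splitL.
Let actP := split_actP splitL.

Lemma split_e_neq0 : e != 0.
Proof.
apply/eqP=> e0; have /act0 : act 1 e = 0 by rewrite poly_act1.
by rewrite dvdp1 (gtn_eqF p_gt1).
Qed.

Lemma lam_component x : lam (x - lam x *: c) = 0.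
Proof. by rewrite linearB linearZ /= lam_c mulr1 subrr. Qed.

Lemma D_component x : D (x - lam x *: c) = D x.
Proof. by rewrite linearB linearZ /= D_c scaler0 subr0. Qed.

Section Automorphism.
Variable f : leibniz_aut L.

Lemma aut_bij : bijective (val f).
Proof. by have /asboolP[] := valP f. Qed.

Lemma aut_bracket x y : val f \[x, y] = \[val f x, val f y].
Proof. by have /asboolP[_ ->] := valP f. Qed.

(** Every x in K annihilates L from the left, hence so does f x, f being
surjective; but a vector outside K does not annihilate e, as D e <> 0. *)
Lemma aut_lam0 x : lam x = 0 -> lam (val f x) = 0.
Proof.
move=> x0; have [g _ gK] := aut_bij.
have /eqP := aut_bracket x (g e).
rewrite !bracketE x0 scale0r linear0 gK eq_sym scaler_eq0.
case/orP=> [/eqP//|/eqP/(D_inj lam_e)/eqP].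
by rewrite (negPf split_e_neq0).
Qed.

Lemma aut_lam x : lam (val f x) = lam (val f c) * lam x.
Proof.
rewrite -{1}(subrK (lam x *: c) x) linearD linearD /=.
by rewrite (aut_lam0 (lam_component x)) !linearZ /= add0r mulrC.
Qed.

(** This is multiplicativity of f at the bracket [c, x] = D x. *)
Lemma aut_D x : val f (D x) = lam (val f c) *: D (val f x).
Proof. by rewrite -bracketE -aut_bracket bracketE lam_c scale1r. Qed.

End Automorphism.

Fact weightM (f g : leibniz_aut L) :
  lam (val (f * g)%g c) = lam (val f c) * lam (val g c).
Proof. by rewrite comp_lfunE aut_lam. Qed.

Fact weight1 : lam (val (1%g : leibniz_aut L) c) = 1.
Proof. by rewrite id_lfunE. Qed.

Fact weight_unit (f : leibniz_aut L) :
  unit_pair (lam (val f c), lam (val f^-1%g c)).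
Proof.
apply/andP; split; apply/eqP.
  by apply: etrans (esym (weightM _ _)) _; rewrite mulgV weight1.
by apply: etrans (esym (weightM _ _)) _; rewrite mulVg weight1.
Qed.

Definition weight (f : leibniz_aut L) : unit_group F := Sub _ (weight_unit f).

Fact weight_gmulfM : {morph weight : f g / (f * g)%g}.
Proof. by move=> f g; apply: unit_group_inj; apply: weightM. Qed.

Fact weight_gmulf1 : weight 1%g = 1%g.
Proof. by apply: unit_group_inj; apply: weight1. Qed.

HB.instance Definition _ := isMultiplicative.Build _ _ weight weight_gmulfM.
HB.instance Definition _ :=
  Multiplicative_isUMagmaMorphism.Build _ _ weight weight_gmulf1.

Lemma weight_kerP (f : leibniz_aut L) :
  reflect (lam (val f c) = 1) (f \in gker weight).
Proof.
apply: (iffP eqP) => [/(congr1 (fun u => (val u).1))//|fc].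
by apply: unit_group_inj.
Qed.

(** The difference of the two sides lies in K and is killed by D, which is
injective on K. *)
Lemma aut_c (f : leibniz_aut L) : val f c = lam (val f c) *: c.
Proof.
apply/eqP; rewrite -subr_eq0; apply/eqP/D_inj.
  by rewrite linearB linearZ /= lam_c mulr1 subrr.
have fc0 : lam (val f c) != 0.
  apply/eqP=> fc0; have /andP[/eqP/=] := weight_unit f.
  by rewrite fc0 mul0r => /esym/eqP; rewrite oner_eq0.
rewrite linearB linearZ /= D_c scaler0 subr0.
have /esym/eqP := aut_D f c; rewrite D_c linear0 scaler_eq0 (negPf fc0).
by move/eqP.
Qed.

Definition c_part (x : L) : L := lam x *: c.

Fact c_part_is_linear : linear c_part.
Proof. by move=> k x y; rewrite /c_part linearP /= scalerDl scalerA. Qed.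

HB.instance Definition _ :=
  GRing.isLinear.Build F L L _ c_part c_part_is_linear.

(** The endomorphism q(D) on K, extended by the identity on F c. *)
Definition extend (q : {poly F}) : 'End(L) :=
  (act q \o (\1 - linfun c_part) + linfun c_part)%VF.

Lemma extendE q x : extend q x = act q (x - lam x *: c) + lam x *: c.
Proof. by rewrite add_lfunE comp_lfunE add_lfunE opp_lfunE id_lfunE !lfunE. Qed.

Lemma extend_lam0 q x : lam x = 0 -> extend q x = act q x.
Proof. by move=> x0; rewrite extendE x0 scale0r subr0 addr0. Qed.

Lemma extend_c q : extend q c = c.
Proof. by rewrite extendE lam_c scale1r subrr linear0 add0r. Qed.

Lemma lam_extend q x : lam (extend q x) = lam x.
Proof.
rewrite extendE [lam (_ + _)]linearD [lam (_ *: _)]linearZ /= lam_c mulr1.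
by rewrite (scalar_poly_act _ lam_D) ?lam_component// add0r.
Qed.

Lemma extendM q r x : extend (q * r) x = extend q (extend r x).
Proof.
by rewrite [RHS]extendE lam_extend !extendE addrK poly_actM.
Qed.

Lemma extend1 x : extend 1 x = x.
Proof. by rewrite extendE poly_act1 subrK. Qed.

Lemma extend_D q x : extend q (D x) = D (extend q x).
Proof.
rewrite extend_lam0// extendE [D (_ + _)]linearD /= [D (_ *: _)]linearZ /=.
by rewrite D_c scaler0 addr0 -poly_actD D_component.
Qed.

Lemma extend_bracket q x y :
  extend q \[x, y] = \[extend q x, extend q y].
Proof. by rewrite !bracketE linearZ /= extend_D lam_extend. Qed.

(** Two polynomials in D agree on K as soon as they agree on its generator e,
because they commute with the polynomial in D that produces a given element of
K from e. *)
Lemma eq_extend q r : p %| q - r <-> extend q = extend r.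
Proof.
rewrite -act0 linearB add_lfunE opp_lfunE; split=> [/subr0_eq qre|qr].
  apply/lfunP=> x; rewrite !extendE; congr (_ + _).
  have [s ->] := actP (lam_component x).
  by rewrite !(poly_actC _ _ _ s) qre.
by apply/eqP; rewrite subr_eq0 -!extend_lam0// qr.
Qed.

Lemma unit_reprK (u : unit_group Q) :
  (forall x, extend (repr (val u).1) (extend (repr (val u).2) x) = x) *
  (forall x, extend (repr (val u).2) (extend (repr (val u).1) x) = x).
Proof.
have ext1 (v w : Q) x : v * w = 1 -> extend (repr v) (extend (repr w) x) = x.
  move=> vw; rewrite -extendM; have /eq_extend<- := repr_quotM v w.
  by rewrite vw; have /eq_extend-> := repr_quot1 p_gt1; rewrite extend1.
by have /andP[/eqP uV /eqP Vu] := valP u; split=> x; exact: ext1.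
Qed.

Fact extend_unit_is_aut (u : unit_group Q) :
  is_leibniz_aut (extend (repr (val u).1)).
Proof.
apply/asboolP; split; last exact: extend_bracket.
by exists (extend (repr (val u).2)) => x; rewrite unit_reprK.
Qed.

Definition extend_aut (u : unit_group Q) : leibniz_aut L :=
  Sub _ (extend_unit_is_aut u).

Fact extend_aut_ker u : extend_aut u \in gker weight.
Proof. by apply/weight_kerP; rewrite /= extend_c lam_c. Qed.

Definition extend_ker (u : unit_group Q) : subgroup_of (gker weight) :=
  Sub (extend_aut u) (extend_aut_ker u).

Fact extend_kerM : {morph extend_ker : u v / (u * v)%g}.
Proof.
move=> u v; apply: val_inj; rewrite [RHS]gmulfM.
apply: val_inj; apply/lfunP=> x.
rewrite /= comp_lfunE -extendM; congr (fun_of_lfun _ x).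
exact/eq_extend/repr_quotM.
Qed.

HB.instance Definition _ := isMultiplicative.Build _ _ extend_ker extend_kerM.

(** An automorphism of weight 1 fixes c and commutes with D, so that it is
determined by the image of e; this image lies in K, hence has the form q(D) e. *)
Lemma ker_extend (f : leibniz_aut L) :
  f \in gker weight -> exists q, val f = extend q.
Proof.
move=> /weight_kerP fc; have [q fe] := actP (aut_lam0 f lam_e).
have fD x : val f (D x) = D (val f x) by rewrite aut_D fc scale1r.
have fcc : val f c = c by rewrite aut_c fc scale1r.
exists q; apply/lfunP=> x; have [s xs] := actP (lam_component x).
rewrite -{1}(subrK (lam x *: c) x) extendE xs linearD linearZ.
congr (_ + _ *: _); last exact: fcc.
by apply: etrans (poly_act_comm _ fD s e) _; rewrite fe poly_actC.
Qed.

(** For surjectivity, the polynomial that represents f is a unit modulo p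
because f^-1 is represented by a polynomial as well. *)
Lemma extend_ker_bij : bijective extend_ker.
Proof.
apply: inj_surj_bij => [u v /(congr1 (fun f => val (val f))) /=|f].
  move/eq_extend/pi_principal; move/(_ p_gt1); rewrite !reprK.
  exact: unit_group_inj.
have [q fq] := ker_extend (valP f).
have [r fr] := ker_extend (gpredVr _ (valP f)).
have fV := congr1 val (mulgV (val f)).
have qr : \pi_Q q * \pi_Q r = 1.
  rewrite -rmorphM -(rmorph1 (\pi_Q)); apply/pi_principal/eq_extend/lfunP=> x.
  rewrite extendM -fq -fr extend1.
  have := congr1 (fun g : 'End(L) => g x) fV.
  by rewrite /= comp_lfunE id_lfunE.
have qr_unit : unit_pair (\pi_Q q, \pi_Q r).
  by rewrite /unit_pair /= [X in _ && (X == _)]mulrC qr eqxx.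
exists (Sub (_, _) qr_unit); apply: val_inj; apply: val_inj; rewrite /= fq.
by apply/eq_extend/(pi_principal p_gt1); rewrite reprK.
Qed.

Theorem split_cyclic_aut :
  exists C : normalClosed (leibniz_aut L),
    isog (subgroup_of C) (unit_group Q)
    /\ exists H : groupClosed (unit_group F),
         isog (quotient_group C) (subgroup_of H).
Proof.
exists (gker weight : normalClosed (leibniz_aut L)); split.
  by apply: isog_sym; exists extend_ker; exact: extend_ker_bij.
by exists (gimage weight : groupClosed (unit_group F)); exact: first_isog.
Qed.

End SplitCyclic.

(** * Left annihilators *)

Section Bracket.
Variables (F : fieldType) (L : leibnizVectType F).

HB.instance Definition _ :=
  bilinear_isBilinear.Build F L L L *:%R *:%R (@bracket F L) bracket_bilinear.

Fact bracket_is_linear (x : L) : linear (bracket x).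
Proof. by move=> k y z; rewrite linearPr. Qed.

HB.instance Definition _ (x : L) :=
  GRing.isLinear.Build F L L _ (bracket x) (bracket_is_linear x).

(** [bracket_leibniz] with the operations of L in the form that the rewriting
rules on abelian groups recognize. *)
Lemma leibniz_identity (x y z : L) :
  \[\[x, y], z] = \[x, \[y, z]] - \[y, \[x, z]].
Proof. exact: bracket_leibniz. Qed.

Lemma bracket_squarel (x y : L) : \[\[x, x], y] = 0.
Proof. by rewrite leibniz_identity subrr. Qed.

Lemma bracket_annl (x z : L) :
  (forall y, \[z, y] = 0) -> forall y, \[\[x, z], y] = 0.
Proof. by move=> z0 y; rewrite leibniz_identity !z0 linear0r subrr. Qed.

End Bracket.

(** * The split form of a cyclic algebra of type (II) *)

Lemma sum_from2 (V : nmodType) (m : nat) (f : nat -> V) :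
  \sum_(2 <= i < m.+3) f i = \sum_(i < m.+1) f i.+2.
Proof. by rewrite !big_add1 big_mkord. Qed.

Section CyclicBasis.
Variables (F : fieldType) (L : leibnizVectType F) (m : nat).
Variables (a : nat -> L) (alpha : nat -> F).
Hypothesis a_basis : cyclic_basis m.+2 a alpha.
Hypothesis alpha2_neq0 : alpha 2%N != 0.
Local Notation p := (cyclic_poly m.+2 alpha).

Definition basis_tuple : m.+2.-tuple L := map_tuple a (iota_tuple m.+2 1).
Local Notation X := basis_tuple.

Definition left_mult : 'End(L) := linfun (bracket (a 1%N)).
Local Notation D := left_mult.

Lemma left_multE x : D x = \[a 1%N, x].
Proof. exact: lfunE. Qed.

Definition basis_coord (i : 'I_m.+2) : {scalar L} := coord X i.
Local Notation coord1 := (basis_coord ord0).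

Lemma cyclic_dim_gt0 : (0 < dim L)%N.
Proof.
by case: a_basis => /(size_basis (X := X)) + _ _; rewrite dimvf => ->.
Qed.

Local Notation act := (poly_act cyclic_dim_gt0 D).

Lemma basis_tupleE (i : 'I_m.+2) : X`_i = a i.+1.
Proof. by rewrite (nth_map 0%N) ?size_iota// nth_iota. Qed.

Lemma coord_basis_tuple (i j : 'I_m.+2) : basis_coord j (a i.+1) = (i == j)%:R.
Proof.
case: a_basis => /basis_free X_free _ _; rewrite -basis_tupleE.
exact: coord_free.
Qed.

Lemma coord_basis_lift (i j : 'I_m.+1) :
  basis_coord (lift ord0 j) (a i.+2) = (i == j)%:R.
Proof.
rewrite -(inj_eq (lift_inj (h := ord0))) -coord_basis_tuple.
by rewrite lift0.
Qed.

Lemma basis_decomp x : x = \sum_i basis_coord i x *: a i.+1.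
Proof.
case: a_basis => X_basis _ _.
rewrite {1}(coord_basis (X := X) X_basis (memvf x)).
by apply: eq_bigr => i _; rewrite basis_tupleE.
Qed.

Lemma left_mult_basis i : (i < m.+1)%N -> D (a i.+1) = a i.+2.
Proof. by case: a_basis => _ aS _ i_lt; rewrite left_multE -aS. Qed.

Lemma left_mult_last : D (a m.+2) = \sum_(i < m.+1) alpha i.+2 *: a i.+2.
Proof. by case: a_basis => _ _ an; rewrite left_multE an sum_from2. Qed.

(** A square annihilates L from the left, and so does [a_1, z] when z does. *)
Lemma derived_annl i y : (i < m.+1)%N -> \[a i.+2, y] = 0.
Proof.
elim: i y => [|i IHi] y i_lt; rewrite -left_mult_basis ?left_multE//.
  exact: bracket_squarel.
by apply: bracket_annl => z; apply: IHi; apply: ltnW.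
Qed.

Lemma cyclic_bracket x y : \[x, y] = coord1 x *: D y.
Proof.
rewrite {1}[x]basis_decomp linear_sumlz big_ord_recl big1 => [|i _].
  by rewrite addr0 linearZl_LR left_multE.
by rewrite linearZl_LR /= [\[_, _]](derived_annl y (ltn_ord i)) scaler0.
Qed.

Lemma coord1_derived i : (i < m.+1)%N -> coord1 (a i.+2) = 0.
Proof.
move=> i_lt; have i_lt2 : (i.+1 < m.+2)%N by [].
exact: (coord_basis_tuple (Ordinal i_lt2) ord0).
Qed.

Lemma coord1_left_mult x : coord1 (D x) = 0.
Proof.
have Da (i : 'I_m.+2) : coord1 (D (a i.+1)) = 0.
  have [i_lt|i_ge] := ltnP i m.+1.
    by rewrite left_mult_basis// coord1_derived.
  have -> : i = m.+1 :> nat by apply/eqP; rewrite eqn_leq i_ge -ltnS ltn_ord.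
  rewrite left_mult_last linear_sum big1// => j _.
  by rewrite linearZ_LR coord1_derived// mulr0.
rewrite [x]basis_decomp linear_sum linear_sum big1// => i _.
by rewrite !linearZ_LR Da mulr0.
Qed.

Lemma act_Xn i : (i < m.+1)%N -> act 'X^i (a 2) = a i.+2.
Proof.
elim: i => [|i IHi] i_lt; first by rewrite poly_act1.
by rewrite exprS poly_actM poly_actX IHi ?left_mult_basis// ltnW.
Qed.

Lemma act_sumXn (k : 'I_m.+1 -> F) :
  act (\sum_(i < m.+1) k i *: 'X^i) (a 2) = \sum_(i < m.+1) k i *: a i.+2.
Proof.
rewrite linear_sum sum_lfunE; apply: eq_bigr => i _.
by rewrite linearZ /= scale_lfunE act_Xn.
Qed.

Lemma coord_act (k : 'I_m.+1 -> F) j :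
  basis_coord (lift ord0 j) (act (\sum_(i < m.+1) k i *: 'X^i) (a 2)) = k j.
Proof.
rewrite act_sumXn linear_sum (bigD1 j)// big1 => [|i ij].
  by rewrite [LHS]addr0 linearZ_LR coord_basis_lift eqxx [LHS]mulr1.
by rewrite linearZ_LR coord_basis_lift (negPf ij) [LHS]mulr0.
Qed.

Lemma cyclic_polyE : p = \sum_(i < m.+1) alpha i.+2 *: 'X^i - 'X^(m.+1).
Proof.
rewrite /cyclic_poly sum_from2 subn1; congr (_ - _).
by apply: eq_bigr => i _; rewrite subn2.
Qed.

Lemma cyclic_poly_neq0 : p != 0.
Proof. by rewrite -size_poly_gt0 ltnW// size_cyclic_poly_gt1. Qed.

Lemma act_cyclic_poly : act p (a 2) = 0.
Proof.
rewrite cyclic_polyE linearB add_lfunE opp_lfunE act_sumXn.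
by rewrite exprS poly_actM poly_actX act_Xn// left_mult_last subrr.
Qed.

Lemma size_cyclic_poly_le : (size p <= m.+2)%N.
Proof.
rewrite cyclic_polyE -(poly_def _ (fun i => alpha i.+2)).
rewrite (leq_trans (size_polyD _ _))// size_polyN.
by rewrite size_polyXn geq_max leqnn (leq_trans (size_poly _ _)).
Qed.

(** The remainder r of q modulo p has degree less than n - 1, where n = m + 2,
and the coefficients of such a polynomial are the coordinates of r(D) a_2
along a_2, ..., a_n. *)
Lemma act_eq0 q : act q (a 2) = 0 <-> p %| q.
Proof.
split=> [|/dvdpP[r ->]]; last by rewrite poly_actM act_cyclic_poly linear0.
rewrite {1}(divp_eq q p) linearD add_lfunE poly_actM act_cyclic_poly linear0.
rewrite add0r => rem0; rewrite /dvdp; apply/eqP/polyP=> i; rewrite coef0.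
have rem_size : (size (q %% p)%R <= m.+1)%N.
  rewrite -ltnS (leq_trans _ size_cyclic_poly_le)//.
  by rewrite ltn_modpN0 ?cyclic_poly_neq0.
have [i_lt|i_ge] := ltnP i m.+1; last first.
  by rewrite nth_default// (leq_trans rem_size).
have remE : (q %% p)%R = \sum_(j < m.+1) (q %% p)%R`_j *: 'X^j.
  rewrite -poly_def; apply/polyP=> j; rewrite coef_poly.
  by case: ltnP => // j_ge; rewrite nth_default// (leq_trans rem_size).
rewrite -(coord_act (fun j => (q %% p)`_j) (Ordinal i_lt)) -remE rem0.
exact: linear0.
Qed.

Lemma act_surj x : coord1 x = 0 -> exists q, x = act q (a 2).
Proof.
move=> x0; exists (\sum_(i < m.+1) basis_coord (lift ord0 i) x *: 'X^i).
rewrite act_sumXn {1}[x]basis_decomp big_ord_recl [basis_coord _ _]x0 scale0r.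
by rewrite add0r; apply: eq_bigr.
Qed.

Lemma cyclic_poly_coprimeX : coprimep p 'X.
Proof.
rewrite coprimepX rootE horner_coef0 cyclic_polyE.
by rewrite -(poly_def _ (fun i => alpha i.+2)) coefB coef_poly coefXn subr0.
Qed.

(** By a Bezout relation u p + v X = 1, v(D) inverts D on K. As D a_1 = a_2,
the vector c = a_1 - v(D) a_2 is killed by D. *)
Lemma cyclic_split :
  exists c, split_cyclic cyclic_dim_gt0 D coord1 c (a 2) p.
Proof.
have /Bezout_eq1_coprimepP[[u v] /= uv] := cyclic_poly_coprimeX.
have actp0 x : coord1 x = 0 -> act (u * p) x = 0.
  move=> /act_surj[q ->]; rewrite poly_actC poly_actM act_cyclic_poly.
  by rewrite !linear0.
have vD x : coord1 x = 0 -> act v (D x) = x.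
  move=> x0; rewrite -[RHS](poly_act1 cyclic_dim_gt0 D) -uv linearD add_lfunE.
  by rewrite actp0// add0r poly_actM poly_actX.
have e0 : coord1 (a 2) = 0 by exact: coord1_derived.
exists (a 1%N - act v (a 2)); split => //.
- exact: cyclic_bracket.
- rewrite linearB /= (scalar_poly_act _ coord1_left_mult)// subr0.
  exact: (coord_basis_tuple ord0 ord0).
- by rewrite linearB /= -poly_actD vD// left_mult_basis// subrr.
- exact: coord1_left_mult.
- by move=> x x0 Dx0; rewrite -(vD x x0) Dx0 linear0.
- by move=> q; apply: act_eq0.
- exact: act_surj.
Qed.

End CyclicBasis.

Theorem theorem4p3 (F : fieldType) (L : leibnizVectType F)
    (n : nat) (n_gt1 : (1 < n)%N) (a : nat -> L) (alpha : nat -> F)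
    (L_cyclic : generated_by (a 1%N))
    (a_basis : cyclic_basis n a alpha)
    (alpha2_neq0 : alpha 2%N != 0) :
  exists C : normalClosed (leibniz_aut L),
    isog (subgroup_of C)
         (unit_group
            {ideal_quot principal_ideal (size_cyclic_poly_gt1 alpha n_gt1)})
    /\ exists H : groupClosed (unit_group F),
         isog (quotient_group C) (subgroup_of H).
Proof.
case: n n_gt1 a_basis => [|[|m]]// n_gt1 a_basis.
have [c splitL] := cyclic_split a_basis alpha2_neq0.
exact: split_cyclic_aut splitL (size_cyclic_poly_gt1 alpha n_gt1).
Qed.
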